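(* Let $A$ be a $4$-dimensional non-split non-Lie nilpotent Leibniz algebra over $\mathbb{C}$ with $\dim(A^2)=2$ and $\dim(\mathrm{Leib}(A))=1=\dim(A^3)$. Then $A$ is isomorphic to a Leibniz algebra spanned by $\{x_1,x_2,x_3,x_4\}$ (a basis) with the nonzero products given by one of the following: $\mathcal{A}_{10}$: $[x_1,x_1]=x_4,\ [x_1,x_2]=x_3=-[x_2,x_1],\ [x_1,x_3]=x_4=-[x_3,x_1]$. $\mathcal{A}_{11}$: $[x_1,x_2]=x_3=-[x_2,x_1],\ [x_2,x_2]=x_4,\ [x_1,x_3]=x_4=-[x_3,x_1]$. $\mathcal{A}_{12}$: $[x_1,x_1]=x_4,\ [x_1,x_2]=x_3,\ [x_2,x_1]=-x_3+x_4,\ [x_1,x_3]=x_4=-[x_3,x_1]$. $\mathcal{A}_{13}$: $[x_2,x_2]=x_4,\ [x_1,x_2]=x_3,\ [x_2,x_1]=-x_3+x_4,\ [x_1,x_3]=x_4=-[x_3,x_1]$.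
   Context: All algebras are over $\mathbb{C}$. A (left) Leibniz algebra is a $\mathbb{C}$-vector space $A$ with a bilinear product $[\,,\,]:A\times A\to A$ such that every left multiplication operator is a derivation, i.e. $[a,[b,c]]=[[a,b],c]+[b,[a,c]]$ for all $a,b,c\in A$. Put $A^1=A$ and $A^i=[A,A^{i-1}]$ (the span of the products) for $i\ge 2$; $A$ is nilpotent if $A^{c+1}=0$ for some positive integer $c$. $\mathrm{Leib}(A)=\mathrm{span}\{[a,a]\mid a\in A\}$; $A$ is a Lie algebra if and only if $\mathrm{Leib}(A)=0$, and ''non-Lie'' means $\mathrm{Leib}(A)\ne 0$. $A$ is split if it is a direct sum of two nontrivial ideals, and non-split otherwise. Products of basis elements not listed are zero. *)

(* Defs.v *)
From HB Require Import structures.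
From mathcomp Require Import all_boot all_order all_algebra.
From mathcomp Require Import ring.
From mathcomp Require Import boolp classical_sets reals.
From mathcomp Require Export complex.

Set Implicit Arguments.
Unset Strict Implicit.
Unset Printing Implicit Defensive.

Import GRing.Theory.

Local Open Scope ring_scope.

(* Left Leibniz algebras of finite dimension, that is, on a vectType. *)
Record leibnizAlgebra (F : fieldType) := LeibnizAlgebra {
  leib_sort :> vectType F;
  bracket : {bilinear leib_sort -> leib_sort -> leib_sort};
  bracket_leibniz : forall a b c : leib_sort,
    bracket a (bracket b c) = bracket (bracket a b) c + bracket b (bracket a c)
}.
Arguments bracket {F l}.

Section Span.
Variables (F : fieldType) (V : vectType F).

Definition is_span (S : set V) (U : {vspace V}) : Prop :=
  forall v, v \in U <->
    exists2 s : seq V, (forall x, x \in s -> S x) & v \in <<s>>%VS.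

(* The span of a possibly infinite set; the default 0 is never used, by
   vspanP. *)
Definition vspan (S : set V) : {vspace V} := xget 0%VS [set U | is_span S U].

Lemma vspanP (S : set V) : is_span S (vspan S).
Proof.
apply: (@xgetPex _ 0%VS [set U | is_span S U]).
pose P n := `[< exists2 s : seq V,
  (forall x, x \in s -> S x) & \dim <<s>>%VS = n >].
have exP : exists n, P n.
  by exists (\dim <<[::] : seq V>>%VS); apply/asboolP; exists [::].
have bP n : P n -> (n <= \dim {:V})%N.
  by move=> /asboolP[s _ <-]; apply/dimvS/subvf.
case: (ex_maxnP exP bP) => n /asboolP[s sS <-] smax.
exists <<s>>%VS => v; split=> [vs|[t tS vt]]; first by exists s.
have st : \dim <<s ++ t>>%VS = \dim <<s>>%VS.
  apply/eqP; rewrite eqn_leq; apply/andP; split.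
    apply: smax; apply/asboolP; exists (s ++ t) => // x.
    by rewrite mem_cat => /orP[/sS|/tS].
  by apply: dimvS; rewrite span_cat addvSl.
have /eqP -> : (<<s>> == <<s ++ t>>)%VS.
  by rewrite eqEdim st leqnn span_cat addvSl.
by rewrite span_cat; apply: subvP (addvSr _ _) _ vt.
Qed.

End Span.

Section LeibnizTheory.
Variable F : fieldType.
Implicit Types A B : leibnizAlgebra F.

Definition brackets A (U V : {vspace A}) : {vspace A} :=
  vspan [set w | exists a b, [/\ a \in U, b \in V & w = bracket a b]].

(* [leib_pow A i] is A^i, with A^1 = A; the value at 0 is junk. *)
Fixpoint leib_pow A (i : nat) : {vspace A} :=
  match i with
  | 0 | 1 => fullv
  | j.+1 => brackets fullv (leib_pow A j)
  end.

Definition leib_nilpotent A : Prop :=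
  exists2 c : nat, (0 < c)%N & leib_pow A c.+1 = 0%VS.

Definition Leib A : {vspace A} := vspan [set w | exists a : A, w = bracket a a].

Definition leib_ideal A (I : {vspace A}) : Prop :=
  forall a x : A, x \in I -> bracket a x \in I /\ bracket x a \in I.

Definition leib_split A : Prop :=
  exists I J : {vspace A},
    [/\ leib_ideal I, leib_ideal J, I != 0%VS & J != 0%VS] /\
    (I + J = fullv)%VS /\ (I :&: J = 0)%VS.

Definition leib_isomorphic A B : Prop :=
  exists f : 'Hom(A, B), bijective f /\
    forall a b : A, f (bracket a b) = bracket (f a) (f b).

End LeibnizTheory.

Section Models.
Variable F : fieldType.

(* x_ 1, ..., x_ 4 is the standard basis of F^4. *)
Definition x_ (k : nat) : 'rV[F]_4 := \row_j (j.+1 == k)%:R.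

(* The bilinear product such that [x_ i, x_ j] = t i j for 1 <= i, j <= 4. *)
Definition table_bracket (t : nat -> nat -> 'rV[F]_4) (u v : 'rV[F]_4) :
    'rV[F]_4 :=
  \sum_(i < 4) \sum_(j < 4) (u 0 i * v 0 j) *: t i.+1 j.+1.

Lemma table_bracket_bilinear t :
  bilinear_for *:%R *:%R (table_bracket t : 'rV[F]_4 -> 'rV[F]_4 -> 'rV[F]_4).
Proof.
split=> w a u v; rewrite /= /table_bracket scaler_sumr -big_split /=;
  apply: eq_bigr => i _; rewrite scaler_sumr -big_split /=;
  apply: eq_bigr => j _; rewrite scalerA -scalerDl !mxE; congr (_ *: _);
  ring.
Qed.

HB.instance Definition _ t :=
  bilinear_isBilinear.Build F 'rV[F]_4 'rV[F]_4 'rV[F]_4 *:%R *:%R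
    (table_bracket t) (table_bracket_bilinear t).

Lemma table_bracketE t i j : (0 < i <= 4)%N -> (0 < j <= 4)%N ->
  table_bracket t (x_ i) (x_ j) = t i j.
Proof.
case: i => // i; case: j => // j /= lti ltj.
rewrite /table_bracket (bigD1 (Ordinal lti)) //= [X in _ + X]big1 => [|k ki].
  rewrite addr0 (bigD1 (Ordinal ltj)) //= [X in _ + X]big1 => [|k kj].
    by rewrite addr0 !mxE /= !eqxx mulr1 scale1r.
  rewrite !mxE !eqSS -[k == j :> nat]/(k == Ordinal ltj) (negPf kj).
  by rewrite mulr0 scale0r.
rewrite big1 // => l _.
rewrite !mxE !eqSS -[k == i :> nat]/(k == Ordinal lti) (negPf ki).
by rewrite mul0r scale0r.
Qed.

Definition table10 (i j : nat) : 'rV[F]_4 :=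
  match i, j with
  | 1, 1 => x_ 4
  | 1, 2 => x_ 3
  | 2, 1 => - x_ 3
  | 1, 3 => x_ 4
  | 3, 1 => - x_ 4
  | _, _ => 0
  end.

Definition table11 (i j : nat) : 'rV[F]_4 :=
  match i, j with
  | 1, 2 => x_ 3
  | 2, 1 => - x_ 3
  | 2, 2 => x_ 4
  | 1, 3 => x_ 4
  | 3, 1 => - x_ 4
  | _, _ => 0
  end.

Definition table12 (i j : nat) : 'rV[F]_4 :=
  match i, j with
  | 1, 1 => x_ 4
  | 1, 2 => x_ 3
  | 2, 1 => - x_ 3 + x_ 4
  | 1, 3 => x_ 4
  | 3, 1 => - x_ 4
  | _, _ => 0
  end.

Definition table13 (i j : nat) : 'rV[F]_4 :=
  match i, j with
  | 2, 2 => x_ 4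
  | 1, 2 => x_ 3
  | 2, 1 => - x_ 3 + x_ 4
  | 1, 3 => x_ 4
  | 3, 1 => - x_ 4
  | _, _ => 0
  end.

Definition leibniz_table t := forall a b c : 'rV[F]_4,
  table_bracket t a (table_bracket t b c) =
  table_bracket t (table_bracket t a b) c +
  table_bracket t b (table_bracket t a c).

Lemma eq_linear_x (f g : 'rV[F]_4 -> 'rV[F]_4) :
    linear f -> linear g ->
    (forall i : nat, (0 < i <= 4)%N -> f (x_ i) = g (x_ i)) ->
  forall u, f u = g u.
Proof.
move=> lf lg fg u.
pose fl := HB.pack_for {linear 'rV[F]_4 -> 'rV[F]_4} f
  (GRing.isLinear.Build F 'rV[F]_4 'rV[F]_4 *:%R f lf).
pose gl := HB.pack_for {linear 'rV[F]_4 -> 'rV[F]_4} g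
  (GRing.isLinear.Build F 'rV[F]_4 'rV[F]_4 *:%R g lg).
have -> : u = \sum_(i < 4) u 0 i *: x_ i.+1.
  rewrite [LHS]row_sum_delta; apply: eq_bigr => i _; congr (_ *: _).
  by apply/rowP => j; rewrite !mxE /= eqSS.
rewrite -[f _]/(fl _) -[g _]/(gl _) !linear_sum; apply: eq_bigr => i _.
by rewrite !linearZ /= fg //= ltn_ord.
Qed.

Lemma leibniz_table_basis t :
    (forall i j k, (0 < i <= 4)%N -> (0 < j <= 4)%N -> (0 < k <= 4)%N ->
      table_bracket t (x_ i) (t j k) =
      table_bracket t (t i j) (x_ k) + table_bracket t (x_ j) (t i k)) ->
  leibniz_table t.
Proof.
move=> tL a b c; move: c; apply: eq_linear_x => [w u v|w u v|k hk].
- by rewrite !linearPr.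
- by rewrite !linearPr scalerDr addrACA.
move: b; apply: eq_linear_x => [w u v|w u v|j hj].
- by rewrite !(linearPl, linearPr).
- by rewrite !(linearPl, linearPr) scalerDr addrACA.
move: a; apply: eq_linear_x => [w u v|w u v|i hi].
- by rewrite !(linearPl, linearPr).
- by rewrite !(linearPl, linearPr) scalerDr addrACA.
by rewrite !table_bracketE // tL.
Qed.

Local Ltac leibniz_table_tac :=
  apply: leibniz_table_basis;
  do 3![case=> [|[|[|[|[|?]]]]] //]; move=> _ _ _ /=;
  rewrite ?(linear0l, linear0r, linearNl, linearNr, linearDl, linearDr) /=;
  rewrite ?table_bracketE //= ?(oppr0, addr0, add0r, opprK, subrr, addNr) //.

Lemma table10_leibniz : leibniz_table table10.
Proof. leibniz_table_tac. Qed.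

Lemma table11_leibniz : leibniz_table table11.
Proof. leibniz_table_tac. Qed.

Lemma table12_leibniz : leibniz_table table12.
Proof. leibniz_table_tac. Qed.

Lemma table13_leibniz : leibniz_table table13.
Proof. leibniz_table_tac. Qed.

Definition A10 : leibnizAlgebra F :=
  @LeibnizAlgebra F 'rV[F]_4 (table_bracket table10) table10_leibniz.
Definition A11 : leibnizAlgebra F :=
  @LeibnizAlgebra F 'rV[F]_4 (table_bracket table11) table11_leibniz.
Definition A12 : leibnizAlgebra F :=
  @LeibnizAlgebra F 'rV[F]_4 (table_bracket table12) table12_leibniz.
Definition A13 : leibnizAlgebra F :=
  @LeibnizAlgebra F 'rV[F]_4 (table_bracket table13) table13_leibniz.

End Models.

(* Main.v *)
From HB Require Import structures.
Require Import Defs.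
From mathcomp Require Import all_boot all_order all_algebra.
From mathcomp Require Import reals complex.
From mathcomp Require Import ring.

(** The Lie algebra A / Leib A is nilpotent and its square is a line, so its
    cube vanishes; hence A^3 = Leib A, and this line is central because
    A^4 = 0 and squares act trivially from the left ([pow3_eq_Leib],
    [bracket_Leibl], [bracket_Leibr0]).

    Lift a basis of A / A^2 to x1, x2 and put x3 = [x1, x2], so that A^2 is
    spanned by x3 and Leib A.  The map a |-> [a, x3] takes values in the line
    Leib A, kills A^2 and is nonzero, so x2 can be taken in its kernel, and
    then z = [x1, x3] spans Leib A.  Everything else is determined by the
    squares [x1, x1] = al z, [x2, x2] = be z and the symmetric part
    [x1, x2] + [x2, x1] = ga z ([ex_normal_basis]).  In other words A is encoded
    by the binary quadratic form

      [p x1 + q x2, p x1 + q x2] = (al p^2 + ga p q + be q^2) z,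

    which is nonzero because Leib A is ([nb_sqr0]).

    Two kinds of base change preserve this shape: the shear
    x1 |-> x1 + q x2 ([nb_shear]) and the scaling x1 |-> p x1, x2 |-> s x2
    ([nb_scale]).  If be <> 0, a root q of al + ga q + be q^2, which exists over
    an algebraically closed field, makes x1 isotropic, and scaling then gives
    A11 when the new ga is zero and A13 otherwise.  If be = 0 and ga <> 0, a
    shear gives al any prescribed value, and the algebra is A12.  If
    be = ga = 0, then al <> 0 and the algebra is A10. *)

Set Implicit Arguments.
Unset Strict Implicit.
Unset Printing Implicit Defensive.

Import GRing.Theory.

Local Open Scope ring_scope.
Local Open Scope complex_scope.

(** * Spans of sets and subspaces of codimension one *)

Section VspanTheory.
Variables (F : fieldType) (V : vectType F).

Lemma mem_vspan (S : classical_sets.set V) x : S x -> x \in vspan S.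
Proof.
move=> Sx; apply/(vspanP S); exists [:: x]; last by rewrite span_seq1 memv_line.
by move=> y; rewrite inE => /eqP ->.
Qed.

Lemma vspan_sub (S : classical_sets.set V) (U : {vspace V}) :
  (forall x, S x -> x \in U) -> (vspan S <= U)%VS.
Proof.
move=> SU; apply/subvP => v /(vspanP S)[s sS].
by apply: subvP v; apply/span_subvP => x /sS /SU.
Qed.

Lemma span_codim1 (U W : {vspace V}) x : (U <= W)%VS ->
  \dim W = (\dim U).+1 -> x \in W -> x \notin U -> W = (<[x]> + U)%VS.
Proof.
move=> UW dW xW xnU; apply/eqP.
rewrite eq_sym eqEdim subv_add UW dW -memvE xW /=.
rewrite ltn_neqAle dimvS ?addvSr // andbT.
apply: contra xnU => /eqP dU; rewrite memvE.
have /eqP -> : (U == <[x]> + U)%VS by rewrite eqEdim addvSr -dU /=.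
exact: addvSl.
Qed.

End VspanTheory.

(** * Lower central series and the ideal of squares *)

Section LeibnizBasics.
Variables (F : fieldType) (A : leibnizAlgebra F).
Implicit Types (a b c u v x y z : A) (U V W : {vspace A}).

Lemma mem_brackets U V a b : a \in U -> b \in V -> bracket a b \in brackets U V.
Proof. by move=> aU bV; apply: mem_vspan; exists a, b. Qed.

Lemma brackets_sub U V W :
    (forall a b, a \in U -> b \in V -> bracket a b \in W) ->
  (brackets U V <= W)%VS.
Proof. by move=> UVW; apply: vspan_sub => _ [a [b [aU bV ->]]]; apply: UVW. Qed.

Lemma bracketsS U V W : (V <= W)%VS -> (brackets U V <= brackets U W)%VS.
Proof.
by move=> /subvP VW; apply: brackets_sub => a b aU /VW bW; apply: mem_brackets.
Qed.

Lemma bracket_pow k a b :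
  b \in leib_pow A k.+1 -> bracket a b \in leib_pow A k.+2.
Proof. exact/mem_brackets/memvf. Qed.

Lemma leib_powS k : (leib_pow A k.+2 <= leib_pow A k.+1)%VS.
Proof. by elim: k => [|k IHk]; [apply: subvf | apply: bracketsS]. Qed.

(** Once two consecutive powers agree, all later ones do too. *)
Lemma leib_pow_stable k :
    leib_nilpotent A -> leib_pow A k.+2 = leib_pow A k.+1 ->
  leib_pow A k.+1 = 0%VS.
Proof.
move=> [c _ Ac0] eqk.
have stab m : leib_pow A (m + k).+1 = leib_pow A k.+1.
  elim: m => // m IHm.
  rewrite addSn -[LHS]/(brackets fullv (leib_pow A (m + k).+1)) IHm.
  exact: eqk.
have lowc m : (leib_pow A (m + c).+1 <= leib_pow A c.+1)%VS.
  by elim: m => // m IHm; apply: subv_trans IHm; rewrite addSn leib_powS.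
apply/eqP; rewrite -subv0 -(stab c) addnC -Ac0; exact: lowc.
Qed.

Lemma bracket_sqr_Leib a : bracket a a \in Leib A.
Proof. by apply: mem_vspan; exists a. Qed.

(** Polarisation of squares: A / Leib A is anticommutative. *)
Lemma bracket_symm_Leib a b : bracket a b + bracket b a \in Leib A.
Proof.
have -> : bracket a b + bracket b a
    = bracket (a + b) (a + b) - bracket a a - bracket b b.
  rewrite linearDl !linearDr /= [X in X - _ - _]addrA [_ - bracket a a]addrAC.
  by rewrite addrK [RHS]addrC -[in RHS]addrA addKr.
by rewrite !rpredB ?bracket_sqr_Leib.
Qed.

End LeibnizBasics.

Section LeibIdeal.
Variables (F : fieldType) (A : leibnizAlgebra F).
Implicit Types (a b c u v x y z : A).

(** The Leibniz identity for a, a, b has [a, [a, b]] on both sides, so the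
    remaining term [[a, a], b] vanishes. *)
Lemma bracket_Leibl z b : z \in Leib A -> bracket z b = 0.
Proof.
have /subvP LK : (Leib A <= lker (linfun (applyr bracket b)))%VS.
  apply: vspan_sub => _ [a ->]; rewrite memv_ker lfunE /=.
  by rewrite -(inj_eq (addIr (bracket a (bracket a b)))) add0r -bracket_leibniz.
by move=> /LK; rewrite memv_ker lfunE /= => /eqP.
Qed.

Lemma bracket_Leibr a z : z \in Leib A -> bracket a z \in Leib A.
Proof.
have /subvP LP : (Leib A <= linfun (bracket a) @^-1: Leib A)%VS.
  apply: vspan_sub => _ [b ->]; rewrite -memv_preim lfunE /=.
  by rewrite bracket_leibniz bracket_symm_Leib.
by move=> /LP; rewrite -memv_preim lfunE.
Qed.

Lemma Leib_sub_pow2 : (Leib A <= leib_pow A 2)%VS.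
Proof. by apply: vspan_sub => _ [a ->]; apply/bracket_pow/memvf. Qed.

Lemma bracketC_mod_Leib a b : exists2 w, w \in Leib A &
  bracket b a = - bracket a b + w.
Proof.
exists (bracket a b + bracket b a); first exact: bracket_symm_Leib.
by rewrite addKr.
Qed.

Lemma bracket_bracketl a b c :
  bracket (bracket a b) c = bracket a (bracket b c) - bracket b (bracket a c).
Proof. by rewrite [bracket a (bracket b c)]bracket_leibniz addrK. Qed.

(** A repetition A^4 = A^3 would never terminate, so A^4 drops below a line. *)
Lemma pow4_eq0 : leib_nilpotent A -> \dim (leib_pow A 3) = 1%N ->
  leib_pow A 4 = 0%VS.
Proof.
move=> nilA d3; apply/eqP/contraT => nz4.
have eq43 : leib_pow A 4 = leib_pow A 3.
  by apply/eqP; rewrite eqEdim leib_powS d3 lt0n dimv_eq0.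
by move: d3; rewrite (leib_pow_stable nilA eq43) dimv0.
Qed.

(** The Lie algebra A / Leib A is nilpotent and its square is a line, so its
    cube vanishes.  Without quotients: an x in A^3 outside Leib A would give
    A^2 = <x> + Leib A, whence A^3 = [A, A^2] is contained in
    A^4 + Leib A = Leib A. *)
Lemma pow3_eq_Leib : leib_nilpotent A -> \dim (leib_pow A 2) = 2%N ->
    \dim (Leib A) = 1%N -> \dim (leib_pow A 3) = 1%N ->
  leib_pow A 3 = Leib A.
Proof.
move=> nilA d2 dL d3; apply/eqP; rewrite eqEdim d3 dL andbT.
apply: contraT => /subvPn[x x3 xnL].
have eq2 := span_codim1 Leib_sub_pow2 (etrans d2 (congr1 S (esym dL)))
  (subvP (leib_powS A 1) x x3) xnL.
suff /subvP/(_ x x3) : (leib_pow A 3 <= Leib A)%VS by rewrite (negPf xnL).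
apply: brackets_sub => a b _.
rewrite -/(leib_pow A 2) eq2 => /memv_addP[_ /vlineP[c ->]].
case=> v /(bracket_Leibr a) av ->.
rewrite linearDr linearZr_LR /=.
have := bracket_pow a x3; rewrite pow4_eq0 // memv0 => /eqP ->.
by rewrite scaler0 add0r.
Qed.

Lemma alternating_add u v : bracket u u = 0 -> bracket v v = 0 ->
  bracket v u = - bracket u v -> bracket (u + v) (u + v) = 0.
Proof.
by move=> u0 v0 vu; rewrite linearDl !linearDr /= u0 v0 vu addr0 add0r subrr.
Qed.

End LeibIdeal.

(** * Recognising an algebra from its multiplication table *)

Section TableIsomorphism.
Variables (F : fieldType) (A : leibnizAlgebra F).

Definition coord_row (e : 4.-tuple A) (v : A) : 'rV[F]_4 := \row_i coord e i v.

Lemma coord_row_is_linear e : linear (coord_row e).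
Proof. by move=> c u v; apply/rowP => i; rewrite !mxE linearP. Qed.

HB.instance Definition _ e :=
  GRing.isLinear.Build F A 'rV[F]_4 *:%R (coord_row e) (coord_row_is_linear e).

Lemma isomorphic_table (t : nat -> nat -> 'rV[F]_4) (tL : leibniz_table t)
    (e : 4.-tuple A) :
    basis_of fullv e ->
    (forall i j : 'I_4,
      bracket e`_i e`_j = \sum_(k < 4) t i.+1 j.+1 0 k *: e`_k) ->
  leib_isomorphic A (@LeibnizAlgebra F 'rV[F]_4 (table_bracket t) tL).
Proof.
move=> be et; have fe := basis_free be.
have coordK v : v = \sum_(i < 4) coord e i v *: e`_i.
  by apply: coord_basis be _; apply: memvf.
exists (linfun (coord_row e)); split.
  exists (fun u : 'rV[F]_4 => \sum_(i < 4) u 0 i *: e`_i) => [v|u].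
    rewrite [RHS]coordK; apply: eq_bigr => i _.
    by rewrite lfunE /= mxE.
  rewrite lfunE; apply/rowP => i.
  by rewrite mxE coord_sum_free.
move=> a b; rewrite !lfunE /=.
rewrite /table_bracket {1}[a]coordK {1}[b]coordK.
rewrite linear_sumlz linear_sum; apply: eq_bigr => i _.
rewrite linear_sumr linear_sum; apply: eq_bigr => j _.
rewrite linearZl_LR linearZr_LR /= scalerA linearZ /= !mxE; congr (_ *: _).
by rewrite et; apply/rowP => k; rewrite !mxE coord_sum_free.
Qed.

End TableIsomorphism.

(** * Bases adapted to the quadratic form of squares *)

Section NormalBasis.
Variables (F : fieldType) (A : leibnizAlgebra F).
Implicit Types (al be ga : F) (a b c x y z : A).

(** The shape shared by the four target tables: they are the cases
    (al, be, ga) = (1,0,0), (0,1,0), (1,0,1), (0,1,1).  The products with x3 on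
    the left follow from the Leibniz identity and are derived below. *)
Record normal_basis al be ga (x1 x2 x3 z : A) : Prop := NormalBasis {
  nb_basis : basis_of fullv [tuple x1; x2; x3; z];
  nb_centl : forall a, bracket z a = 0;
  nb_centr : forall a, bracket a z = 0;
  nb11 : bracket x1 x1 = al *: z;
  nb12 : bracket x1 x2 = x3;
  nb21 : bracket x2 x1 = - x3 + ga *: z;
  nb22 : bracket x2 x2 = be *: z;
  nb13 : bracket x1 x3 = z;
  nb23 : bracket x2 x3 = 0 }.

Definition normal_table al be ga (i j : nat) : 'rV[F]_4 :=
  match i, j with
  | 1, 1 => al *: x_ F 4
  | 1, 2 => x_ F 3
  | 2, 1 => - x_ F 3 + ga *: x_ F 4
  | 2, 2 => be *: x_ F 4
  | 1, 3 => x_ F 4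
  | 3, 1 => - x_ F 4
  | _, _ => 0
  end.

Section Products.
Variables (al be ga : F) (x1 x2 x3 z : A).
Hypothesis nb : normal_basis al be ga x1 x2 x3 z.

Lemma nb31 : bracket x3 x1 = - z.
Proof.
rewrite -(nb12 nb) bracket_bracketl (nb21 nb) (nb11 nb) linearDr /= linearNr /=.
by rewrite !linearZr_LR /= (nb13 nb) !(nb_centr nb) !scaler0 addr0 subr0.
Qed.

Lemma nb32 : bracket x3 x2 = 0.
Proof.
rewrite -{1}(nb12 nb) bracket_bracketl (nb12 nb) (nb22 nb) (nb23 nb).
by rewrite linearZr_LR /= (nb_centr nb) scaler0 subr0.
Qed.

Lemma nb33 : bracket x3 x3 = 0.
Proof.
rewrite -{1}(nb12 nb) bracket_bracketl (nb13 nb) (nb23 nb) (nb_centr nb).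
by rewrite linear0r subr0.
Qed.

Definition nbE := (nb_centl nb, nb_centr nb, nb11 nb, nb12 nb, nb21 nb,
  nb22 nb, nb13 nb, nb23 nb, nb31, nb32, nb33).

Lemma nb_isomorphic t (tL : leibniz_table t) : t =2 normal_table al be ga ->
  leib_isomorphic A (@LeibnizAlgebra F 'rV[F]_4 (table_bracket t) tL).
Proof.
move=> tE; apply: isomorphic_table (nb_basis nb) _ => i j.
rewrite tE; case: i j => [[|[|[|[|i]]]] lti] [[|[|[|[|j]]]] ltj] //=;
  rewrite !nbE !big_ord_recl big_ord0 !mxE /=;
  by rewrite ?(mulr0, mulr1, oppr0, addr0, add0r, scale0r, scale1r, scaleNr).
Qed.

(** A quadratic map vanishes once it vanishes on a basis together with its
    polarisation; for a |-> [a, a] on a normal basis, the only values to be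
    checked are al z, be z and ga z. *)
Lemma nb_sqr0 : al = 0 -> be = 0 -> ga = 0 -> Leib A = 0%VS.
Proof.
move=> al0 be0 ga0; apply/eqP; rewrite -subv0.
apply: vspan_sub => _ [a ->]; rewrite memv0; apply/eqP.
have [c1 [c2 [c3 [c4 ->]]]] : exists c1 c2 c3 c4 : F,
    a = c1 *: x1 + (c2 *: x2 + (c3 *: x3 + c4 *: z)).
  have := coord_basis (nb_basis nb) (memvf a).
  by rewrite !big_ord_recl big_ord0 /= addr0 => ->; do 4!eexists.
do 3?apply: alternating_add;
  rewrite ?linearDl ?linearDr /= ?linearDl ?linearDr /=
    !(linearZl_LR, linearZr_LR) /= !nbE ?al0 ?be0 ?ga0;
  rewrite ?(scale0r, scaler0, addr0, oppr0, scalerN) //.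
by rewrite opprD !scalerA ![_ * c1]mulrC.
Qed.

End Products.

End NormalBasis.

(** * Shears and scalings *)

Section FrameChange.
Variables (F : fieldType) (A : leibnizAlgebra F).
Variables (al be ga : F) (x1 x2 x3 z : A).
Hypothesis nb : normal_basis al be ga x1 x2 x3 z.

(** Testing on arbitrary subspaces U reduces spanning to closure of U under
    linear combinations. *)
Lemma nb_basis_change (y1 y2 y3 y4 : A) :
    (forall U : {vspace A}, y1 \in U -> y2 \in U -> y3 \in U -> y4 \in U ->
      [/\ x1 \in U, x2 \in U, x3 \in U & z \in U]) ->
  basis_of fullv [tuple y1; y2; y3; y4].
Proof.
move=> yx; have bx := nb_basis nb; set s := [tuple y1; _; _; _].
have [] : [/\ x1 \in <<s>>%VS, x2 \in <<s>>%VS, x3 \in <<s>>%VS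
             & z \in <<s>>%VS].
  by apply: yx; apply: memv_span; rewrite !inE eqxx ?orbT.
move=> s1 s2 s3 s4.
rewrite basisEdim size_tuple (size_basis bx) leqnn andbT -(span_basis bx).
by apply/span_subvP => y; rewrite !inE => /or4P[] /eqP ->.
Qed.

(** The new ga is the polar form of the quadratic form at the new x1 and x2;
    x3 changes because [x1 + q x2, x2] picks up q [x2, x2]. *)
Lemma nb_shear q :
  normal_basis (al + ga * q + be * q ^+ 2) be (ga + be * q *+ 2)
    (x1 + q *: x2) x2 (x3 + (q * be) *: z) z.
Proof.
split; try by move=> a; rewrite !(nbE nb).
- apply: nb_basis_change => U U1 U2 U3 U4; split=> //.
    by rewrite -(addrK (q *: x2) x1) rpredB ?rpredZ.
  by rewrite -(addrK ((q * be) *: z) x3) rpredB ?rpredZ.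
- rewrite linearDl !linearDr /= !(linearZl_LR, linearZr_LR) /= !(nbE nb).
  rewrite -addrA [q *: _ + _]addrA -scalerDr addrA addrC [x3 + _]addrA subrr.
  by rewrite add0r !scalerA -!scalerDl; congr (_ *: _); ring.
- by rewrite linearDl linearZl_LR /= !(nbE nb) scalerA.
- rewrite linearDr linearZr_LR /= !(nbE nb) scalerA opprD -!addrA.
  by rewrite -scaleNr -!scalerDl; congr (_ + _ *: _); ring.
- by rewrite !(nbE nb).
- by rewrite linearDl !linearDr /= !(linearZl_LR, linearZr_LR) /= !(nbE nb)
    !scaler0 !addr0.
- by rewrite !linearDr /= linearZr_LR /= !(nbE nb) scaler0 addr0.
Qed.

Lemma nb_scale p s : p != 0 -> s != 0 ->
  normal_basis (al / s) (s * be / p ^+ 2) (ga / p)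
    (p *: x1) (s *: x2) ((p * s) *: x3) ((p ^+ 2 * s) *: z).
Proof.
move=> p0 s0; split.
- have scaleVK c (v : A) (U : {vspace A}) : c != 0 -> c *: v \in U -> v \in U.
    by move=> c0 cv; rewrite -(scalerK c0 v) rpredZ.
  apply: nb_basis_change => U /scaleVK-> // /scaleVK-> // /scaleVK-> //.
    by move=> /scaleVK->; rewrite ?mulf_neq0 ?expf_neq0.
  by rewrite mulf_neq0.
- by move=> a; rewrite linearZl_LR /= (nb_centl nb) scaler0.
- by move=> a; rewrite linearZr_LR /= (nb_centr nb) scaler0.
- rewrite linearZl_LR linearZr_LR /= !(nbE nb) !scalerA; congr (_ *: _).
  by field.
- by rewrite linearZl_LR linearZr_LR /= !(nbE nb) !scalerA.
- rewrite linearZl_LR linearZr_LR /= !(nbE nb) !scalerDr !scalerN !scalerA.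
  by congr (- (_ *: _) + _ *: _); first ring; field.
- rewrite linearZl_LR linearZr_LR /= !(nbE nb) !scalerA; congr (_ *: _).
  by field.
- rewrite linearZl_LR linearZr_LR /= !(nbE nb) !scalerA; congr (_ *: _); ring.
- by rewrite linearZl_LR linearZr_LR /= !(nbE nb) !scaler0.
Qed.

End FrameChange.

(** * Existence of an adapted basis *)

Section Existence.
Variables (F : fieldType) (A : leibnizAlgebra F).
Hypotheses (nilA : leib_nilpotent A) (dimA : \dim {:A} = 4%N).
Hypotheses (dimA2 : \dim (leib_pow A 2) = 2%N) (dimLeib : \dim (Leib A) = 1%N).
Hypothesis dimA3 : \dim (leib_pow A 3) = 1%N.
Implicit Types a b u v w x y z : A.

Let eq3L := pow3_eq_Leib nilA dimA2 dimLeib dimA3.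

Lemma bracket_pow2_Leib a v : v \in leib_pow A 2 -> bracket a v \in Leib A.
Proof. by rewrite -eq3L; apply: bracket_pow. Qed.

Lemma bracket_Leibr0 a v : v \in Leib A -> bracket a v = 0.
Proof.
rewrite -eq3L => /(bracket_pow a).
by rewrite pow4_eq0 // memv0 => /eqP.
Qed.

Lemma bracketl_pow2_Leib a v : v \in leib_pow A 2 -> bracket v a \in Leib A.
Proof.
move=> v2; have [w wL ->] := bracketC_mod_Leib a v.
by rewrite rpredD ?rpredN ?bracket_pow2_Leib.
Qed.

(** Otherwise x1 and x2 would commute modulo Leib A; as A^2 is central modulo
    A^3 = Leib A, all products would fall in the line Leib A. *)
Lemma generators_bracket_notin_Leib x1 x2 :
    (<[x1]> + <[x2]> + leib_pow A 2 = fullv)%VS ->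
  bracket x1 x2 \notin Leib A.
Proof.
move=> gen; apply/negP => x3L.
have x3L' : bracket x2 x1 \in Leib A.
  by have [w wL ->] := bracketC_mod_Leib x1 x2; rewrite rpredD ?rpredN.
suff /dimvS : (leib_pow A 2 <= Leib A)%VS by rewrite dimA2 dimLeib.
have decomp a : exists c d u, u \in leib_pow A 2 /\ a = c *: x1 + d *: x2 + u.
  have := memvf a; rewrite -gen => /memv_addP[y /memv_addP[_ /vlineP[c ->]]].
  by case=> _ /vlineP[d ->] -> [u u2 ->]; exists c, d, u.
apply: brackets_sub => a b _ _.
have [c [d [u [u2 ->]]]] := decomp a; have [c' [d' [v [v2 ->]]]] := decomp b.
rewrite !(linearDl, linearDr) /= !(linearZl_LR, linearZr_LR) /=.
do !apply: rpredD; do ?apply: rpredZ => //; try exact: bracket_sqr_Leib;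
  solve [exact: bracket_pow2_Leib | exact: bracketl_pow2_Leib].
Qed.

(** Here z cannot vanish: A^2 is spanned by x3 and the central line Leib A, so
    [x1, x3] = [x2, x3] = 0 would force A^3 = [A, A^2] = 0.  Therefore z spans
    Leib A, and all squares and symmetrised products are multiples of z. *)
Lemma normal_basis_of_generators x1 x2 :
    (<[x1]> + <[x2]> + leib_pow A 2 = fullv)%VS ->
    bracket x2 (bracket x1 x2) = 0 ->
  exists al be ga,
    normal_basis al be ga x1 x2 (bracket x1 x2) (bracket x1 (bracket x1 x2)).
Proof.
move=> gen; set x3 := bracket x1 x2; set z := bracket x1 x3 => x230.
have x3A2 : x3 \in leib_pow A 2 by apply: bracket_pow; apply: memvf.
have eq2 : leib_pow A 2 = (<[x3]> + Leib A)%VS.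
  apply: span_codim1 => //; first exact: Leib_sub_pow2.
    by rewrite dimA2 dimLeib.
  exact: generators_bracket_notin_Leib.
have zL : z \in Leib A by apply: bracket_pow2_Leib.
have z0 : z != 0.
  apply/eqP => z0; have x33 : bracket x3 x3 = 0.
    by rewrite {1}/x3 bracket_bracketl x230 -/z z0 !linear0r subr0.
  suff : leib_pow A 3 = 0%VS by move=> A30; move: dimA3; rewrite A30 dimv0.
  apply/eqP; rewrite -subv0; apply: brackets_sub => a b _.
  rewrite -/(leib_pow A 2) eq2 => /memv_addP[_ /vlineP[k ->] [v vL ->]].
  have := memvf a; rewrite -gen => /memv_addP[y /memv_addP[_ /vlineP[c ->]]].
  case=> _ /vlineP[d ->] -> [u]; rewrite eq2 => /memv_addP[_ /vlineP[e ->]].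
  case=> w wL -> ->; rewrite memv0 linearDr /= (bracket_Leibr0 _ vL) addr0.
  rewrite !linearDl !(linearZl_LR, linearZr_LR) /= -/z z0 x230 x33.
  by rewrite (bracket_Leibl _ wL) !scaler0 !addr0.
have eqL : Leib A = <[z]>%VS.
  by apply/esym/eqP; rewrite eqEdim -memvE zL dim_vline z0 dimLeib.
have := bracket_sqr_Leib x1; rewrite eqL => /vlineP[al alE].
have := bracket_sqr_Leib x2; rewrite eqL => /vlineP[be beE].
have [w] := bracketC_mod_Leib x1 x2; rewrite eqL => /vlineP[ga ->] gaE.
exists al, be, ga; split=> //.
- rewrite basisEdim dimA leqnn andbT -gen eq2 eqL !subv_add.
  by rewrite -!memvE !memv_span // !inE eqxx ?orbT.
- by move=> a; apply: bracket_Leibl.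
- by move=> a; apply: bracket_Leibr0.
Qed.

Lemma ex_generators : exists x1 x2,
  (<[x1]> + <[x2]> + leib_pow A 2 = fullv)%VS.
Proof.
have dC : \dim (leib_pow A 2)^C = 2%N by rewrite dimv_compl dimA dimA2.
have := span_basis (vbasisP (leib_pow A 2)^C).
case: (vbasis _) => s /= /eqP; rewrite dC.
case: s => [|u [|v [|]]] //= _; rewrite span_cons span_seq1 => uvC.
by exists u, v; rewrite uvC addvC addv_complf.
Qed.

(** For any generators b1, b2, the products [b1, x3] and [b2, x3] lie in the
    same line, so some nontrivial combination of b1 and b2 kills x3. *)
Lemma ex_normal_basis : exists al be ga x1 x2 x3 z,
  @normal_basis F A al be ga x1 x2 x3 z.
Proof.
suff [x1 [x2 [gen x230]]] : exists x1 x2,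
    (<[x1]> + <[x2]> + leib_pow A 2 = fullv)%VS /\
    bracket x2 (bracket x1 x2) = 0.
  have [al [be [ga nb]]] := normal_basis_of_generators gen x230.
  by exists al, be, ga, x1, x2; do 2!eexists; exact: nb.
have [b1 [b2 gen]] := ex_generators.
have [b20|w0] := eqVneq (bracket b2 (bracket b1 b2)) 0; first by exists b1, b2.
set x3 := bracket b1 b2 in w0.
have x3A2 : x3 \in leib_pow A 2 by apply: bracket_pow; apply: memvf.
have eqL : Leib A = <[bracket b2 x3]>%VS.
  apply/esym/eqP; rewrite eqEdim -memvE bracket_pow2_Leib //.
  by rewrite dim_vline w0 dimLeib.
have := bracket_pow2_Leib b1 x3A2; rewrite eqL => /vlineP[c cE].
(* With [b1, x3] = c [b2, x3], the vector b1 - c b2 kills x3; the bracket of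
   the new pair is - x3 modulo the central Leib A. *)
exists b2, (b1 - c *: b2); split.
  apply/eqP; rewrite eqEsubv subvf -gen /= !subv_add addvSr andbT -!memvE.
  have m2 : b2 \in (<[b2]> + <[b1 - c *: b2]> + leib_pow A 2)%VS.
    by rewrite -addvA memvE addvSl.
  rewrite m2 andbT -[X in X \in _](subrK (c *: b2)) rpredD ?rpredZ //.
  by rewrite memvE; apply: subv_trans (addvSl _ _); apply: addvSr.
have [w wL wE] := bracketC_mod_Leib b1 b2.
rewrite linearBr linearZr_LR /= wE -/x3.
rewrite linearBr linearZr_LR linearDr /= linearNr /= (bracket_Leibr0 _ wL).
rewrite (bracket_Leibr0 _ (bracket_sqr_Leib _)) scaler0 addr0 subr0.
by rewrite linearBl linearZl_LR /= cE subrr oppr0.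
Qed.

End Existence.

(** * Reduction of the quadratic form *)

Lemma quadratic_root (F : closedFieldType) (a b c : F) : c != 0 ->
  exists q, a + b * q + c * q ^+ 2 = 0.
Proof.
move=> c0; have [q qE] := @solve_monicpoly F 2
  (fun i => if i == 0%N then - a / c else - b / c) isT.
exists q; rewrite qE !big_ord_recl big_ord0 /=.
by field.
Qed.

Local Ltac compare_tables :=
  move=> [|[|[|[|i]]]] [|[|[|[|j]]]]; rewrite //= ?scale0r ?scale1r ?addr0.

(** The list of four algebras needs only a root of a quadratic polynomial in
    one variable, so it holds over any algebraically closed field, including
    characteristic two, where completing the square would fail. *)
Theorem classification_closedField (F : closedFieldType)
    (A : leibnizAlgebra F) :
    \dim {:A} = 4%N -> Leib A <> 0%VS -> leib_nilpotent A ->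
    \dim (leib_pow A 2) = 2%N -> \dim (Leib A) = 1%N ->
    \dim (leib_pow A 3) = 1%N ->
  leib_isomorphic A (A10 F) \/ leib_isomorphic A (A11 F) \/
  leib_isomorphic A (A12 F) \/ leib_isomorphic A (A13 F).
Proof.
move=> dimA nLie nilA dimA2 dimL dimA3.
have [al [be [ga [x1 [x2 [x3 [z nb]]]]]]] :=
  ex_normal_basis nilA dimA dimA2 dimL dimA3.
have [be0|be0] := eqVneq be 0; last first.
  (* The shear by this root makes x1 isotropic. *)
  have [q q0] := quadratic_root al ga be0.
  have := nb_shear nb q; rewrite q0; set ga' := ga + _ => nb1.
  have [ga0|ga0] := eqVneq ga' 0.
    have := nb_scale nb1 (oner_neq0 F) (invr_neq0 be0).
    rewrite ga0 !mul0r expr1n divr1 mulVf // => nb2.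
    right; left; apply: (nb_isomorphic nb2).
    by compare_tables.
  have := nb_scale nb1 ga0 (mulf_neq0 (expf_neq0 2 ga0) (invr_neq0 be0)).
  rewrite mul0r divff // divfK // divff ?expf_neq0 // => nb2.
  do 3!right; apply: (nb_isomorphic nb2).
  by compare_tables.
have [ga0|ga0] := eqVneq ga 0.
  have al0 : al != 0.
    by apply/eqP => al0; apply: nLie; apply: (nb_sqr0 nb).
  have := nb_scale nb (oner_neq0 F) al0.
  rewrite be0 ga0 mulr0 !mul0r divff // => nb2.
  left; apply: (nb_isomorphic nb2).
  by compare_tables.
(* With be = 0 the shear by q adds ga q to al. *)
have := nb_scale (nb_shear nb ((1 - al) / ga)) ga0 (oner_neq0 F).
rewrite be0 !mul0r mul0rn !addr0 mulr0 mul0r divr1 divff // mulrC divfK //.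
rewrite addrC subrK => nb2.
do 2!right; left; apply: (nb_isomorphic nb2).
by compare_tables.
Qed.

Theorem theorem2p4 (R : realType) (A : leibnizAlgebra R[i])
    (dimA : \dim {:A} = 4%N)
    (nsA : ~ leib_split A)
    (nLieA : Leib A <> 0%VS)
    (nilA : leib_nilpotent A)
    (dimA2 : \dim (leib_pow A 2) = 2%N)
    (dimLeib : \dim (Leib A) = 1%N)
    (dimA3 : \dim (leib_pow A 3) = 1%N) :
  leib_isomorphic A (A10 R[i]) \/ leib_isomorphic A (A11 R[i]) \/
  leib_isomorphic A (A12 R[i]) \/ leib_isomorphic A (A13 R[i]).
Proof. exact: classification_closedField. Qed.
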